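(* Let $G=([n],H)$ be a $q$-uniform hypergraph with $n$ vertices and $m$ hyperedges, with non-backtracking matrix $B$, adjacency matrix $A$, degree matrix $D$ and associated $2n\times2n$ matrix $\tilde B$. The following identity holds for any $z\in\mathbb C$: $$\det(B-zI)=(z-1)^{(q-1)m-n}\,(z+(q-1))^{m-n}\,\det\left((z^2+(q-2)z)I-zA+(q-1)(D-I)\right).$$ In particular, the spectrum of $\tilde B$ is identical to that of $B$, except for possible trivial eigenvalues at $1$ and $-(q-1)$. If additionally $m\ge n$, then the trivial eigenvalue of $B$ located at $1$ has multiplicity $(q-1)m-n$, and the eigenvalue $-(q-1)$ has multiplicity $m-n$.
   Context: Let $q\ge2$. A $q$-uniform hypergraph $G=(V,H)$ on $V=[n]$ has a set $H$ of hyperedges which are $q$-element subsets of $V$; $m=|H|$. The set of oriented hyperedges is $\vec H=\{(x,e):e\in H,\ x\in e\}$, with $(x,e)$ written $x\to e$. The non-backtracking matrix $B$ is the $\vec H\times\vec H$ matrix (size $qm\times qm$) with $B_{(x\to e),(y\to f)}=1$ if $y\in e\setminus\{x\}$ and $f\ne e$, and $0$ otherwise. The adjacency matrix $A\in\mathbb R^{n\times n}$ has $A_{xy}=\#\{e\in H:\{x,y\}\subset e\}$ for $x\ne y$ and $A_{xx}=0$. The degree matrix $D$ is diagonal with $D_{xx}=\#\{e\in H:x\in e\}$. The matrix $\tilde B$ is $$\tilde B=\begin{pmatrix}0&D-I\\-(q-1)I&A-(q-2)I\end{pmatrix}.$$ Here $I$ denotes the identity matrix of the appropriate size.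
   Formalization: The printed identity lacks a factor (-1)^{qm} on the right, inserted here; points where a negative power of 0 occurs are treated with denominators cleared; the multiplicities (q-1)m-n and m-n are those B has in addition to the multiplicity of the same eigenvalue in B-tilde. *)

(* Defs.v *)
From HB Require Import structures.
From mathcomp Require Export all_boot all_order all_algebra.
From mathcomp Require Export complex.
From mathcomp Require Export reals.

Set Implicit Arguments.
Unset Strict Implicit.
Unset Printing Implicit Defensive.

Export Order.TTheory GRing.Theory Num.Theory.
Local Open Scope ring_scope.

Section Hypergraph.

Variables (n : nat) (H : {set {set 'I_n}}).

Definition uniform_hypergraph (q : nat) : Prop :=
  forall e, e \in H -> #|e| = q.

(* The pair (x, e) is the oriented hyperedge x -> e. *)
Definition oriented : {set 'I_n * {set 'I_n}} :=
  [set xe | (xe.2 \in H) && (xe.1 \in xe.2)].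

Definition nb_step (a b : 'I_n * {set 'I_n}) : bool :=
  (b.1 \in a.2 :\ a.1) && (b.2 != a.2).

Variable R : pzRingType.

(* Rows and columns are indexed by the oriented hyperedges through [enum_val];
   #|oriented| = q * #|H| for a q-uniform hypergraph. *)
Definition nb_matrix : 'M[R]_#|oriented| :=
  \matrix_(i, j) (nb_step (enum_val i) (enum_val j))%:R.

Definition adjacency : 'M[R]_n :=
  \matrix_(x, y)
    if x == y then 0 else #|[set e in H | [set x; y] \subset e]|%:R.

Definition degree_matrix : 'M[R]_n :=
  diag_mx (\row_x #|[set e in H | x \in e]|%:R).

Definition nb_tilde (q : nat) : 'M[R]_(n + n) :=
  block_mx 0                      (degree_matrix - 1%:M)
           (- (q%:R - 1) *: 1%:M) (adjacency - (q%:R - 2%:R) *: 1%:M).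

End Hypergraph.

Arguments nb_matrix {n} H R.
Arguments adjacency {n} H R.
Arguments degree_matrix {n} H R.
Arguments nb_tilde {n} H R q.

(* Main.v *)
(** Write [E] and [V] for the matrices recording the edge and the vertex of each
    oriented hyperedge, and [K = E E^T], [Q = V V^T].  Then
    [B = (K - 1) (Q - 1)], so [z - B = (K + z - 1) - (K - 1) Q].  As [K^2 = q K],
    the first summand has an explicit inverse up to a scalar, and Sylvester's
    identity for [det (c - X Y)] replaces the rank [n] perturbation [V V^T] by an
    [n x n] determinant, computed from [V^T V = D] and [V^T K V = A + D].  The
    argument is run without division over a commutative ring, at [z = 'X]; the
    surplus powers of [X - 1] and [X + q - 1] are then cancelled among
    polynomials, which yields the identity at every [z] and all the
    multiplicities. *)
Require Import Defs.
From mathcomp Require Import ring zify.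
Set Implicit Arguments.
Unset Strict Implicit.
Unset Printing Implicit Defensive.
Local Open Scope ring_scope.

(** * Division-free determinant identities over a commutative ring *)

(** Two block eliminations of the matrix with rows [c, X] and [Y, 1]. The second scales the lower
    row by [c] instead of dividing by it, hence the powers of [c], which may be a zero divisor. *)
Lemma det_scalar_sub_mulmxC (S : comPzRingType) (a b : nat) (c : S)
    (X : 'M[S]_(a, b)) (Y : 'M[S]_(b, a)) :
  c ^+ b * \det (c%:M - X *m Y) = c ^+ a * \det (c%:M - Y *m X).
Proof.
have Hl : \det (block_mx c%:M X Y 1%:M) = \det (c%:M - X *m Y).
  have := det_mulmx (block_mx 1%:M (- X) 0 1%:M) (block_mx c%:M X Y 1%:M).
  rewrite mulmx_block !mul1mx !mul0mx !mulmx1 addrN !add0r mulNmx.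
  by rewrite det_lblock det_ublock !det1 !mul1r mulr1 => <-.
have := det_mulmx (block_mx 1%:M 0 (- Y) c%:M) (block_mx c%:M X Y 1%:M).
rewrite mulmx_block !mul1mx !mul0mx !mulmx1 !addr0 !mulNmx.
rewrite mul_mx_scalar mul_scalar_mx addNr det_ublock det_lblock !det_scalar.
by rewrite Hl expr1n mul1r addrC => ->.
Qed.

(** Reduces the characteristic determinant of [nb_tilde] from size [n + n] to size [n]; scaling the
    lower row by [z] costs [z ^+ n]. *)
Lemma det_block_scalarl (S : comPzRingType) (n : nat) (z a : S)
    (X Y : 'M[S]_n) :
  z ^+ n * \det (block_mx z%:M X a%:M Y) = z ^+ n * \det (z *: Y - a *: X).
Proof.
have := det_mulmx (block_mx 1%:M 0 (- a)%:M z%:M) (block_mx z%:M X a%:M Y).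
rewrite mulmx_block !mul1mx !mul0mx !addr0 !mul_scalar_mx.
rewrite !scale_scalar_mx mulNr mulrC -rmorphD addNr raddf0.
rewrite det_ublock det_lblock !det_scalar expr1n mul1r => <-.
by rewrite scaleNr addrC.
Qed.

(** * Incidence matrices and the factorization of the non-backtracking matrix *)

Section Incidence.

Variables (n q : nat) (H : {set {set 'I_n}}) (S : comPzRingType).
Hypothesis hH : uniform_hypergraph H q.

Definition edge_incidence : 'M[S]_(#|oriented H|, #|H|) :=
  \matrix_(i, k) ((enum_val i).2 == enum_val k)%:R.

Definition vertex_incidence : 'M[S]_(#|oriented H|, n) :=
  \matrix_(i, x) ((enum_val i).1 == x)%:R.

Local Notation E := edge_incidence.
Local Notation V := vertex_incidence.

Lemma enum_val_oriented (i : 'I_#|oriented H|) :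
  ((enum_val i).2 \in H) && ((enum_val i).1 \in (enum_val i).2).
Proof. by have := enum_valP i; rewrite inE. Qed.

Lemma big_oriented (T : Type) (idx : T) (op : Monoid.com_law idx)
    (F : 'I_n * {set 'I_n} -> T) :
  \big[op/idx]_(p in oriented H) F p =
  \big[op/idx]_(e in H) \big[op/idx]_(x in e) F (x, e).
Proof.
rewrite [RHS](exchange_big_dep xpredT) //= pair_big_dep /=.
by apply: eq_big => [[x e]|[x e] _] //; rewrite inE.
Qed.

Lemma sum_oriented (F : 'I_n * {set 'I_n} -> S) :
  \sum_(i < #|oriented H|) F (enum_val i) =
  \sum_(e in H) \sum_(x in e) F (x, e).
Proof. by rewrite -big_enum_val big_oriented. Qed.

Lemma sum_delta (I : finType) (A : {pred I}) (a : I) (F : I -> S) :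
  \sum_(k in A) (a == k)%:R * F k = (a \in A)%:R * F a.
Proof.
case: (boolP (a \in A)) => aA.
  rewrite (bigD1 a) //= eqxx big1 ?addr0 // => k /andP[_ /negPf].
  by rewrite eq_sym => ->; rewrite mul0r.
rewrite mul0r big1 // => k kA; case: eqP kA => [<-|_ _]; last by rewrite mul0r.
by rewrite (negPf aA).
Qed.

Lemma sum_delta1 (I : finType) (A : {pred I}) (a : I) :
  \sum_(k in A) (a == k)%:R = (a \in A)%:R :> S.
Proof. by under eq_bigr do rewrite -[_%:R]mulr1; rewrite sum_delta mulr1. Qed.

Lemma card_oriented : #|oriented H| = (q * #|H|)%N.
Proof.
rewrite -sum1_card big_oriented /= mulnC -sum_nat_const.
by apply: eq_bigr => e eH; rewrite sum1_card hH.
Qed.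

Lemma edge_incidence_mulT :
  E *m E^T = \matrix_(i, j) ((enum_val i).2 == (enum_val j).2)%:R.
Proof.
apply/matrixP => i j; rewrite !mxE.
under eq_bigr do rewrite !mxE.
rewrite -(big_enum_val (fun e => ((enum_val i).2 == e)%:R
   * ((enum_val j).2 == e)%:R)) sum_delta.
by case/andP: (enum_val_oriented i) => -> _; rewrite mul1r eq_sym.
Qed.

Lemma vertex_incidence_mulT :
  V *m V^T = \matrix_(i, j) ((enum_val i).1 == (enum_val j).1)%:R.
Proof.
apply/matrixP => i j; rewrite !mxE.
under eq_bigr do rewrite !mxE.
by rewrite (sum_delta predT) mul1r eq_sym.
Qed.

Lemma edge_incidence_Tmul : E^T *m E = q%:R%:M.
Proof.
apply/matrixP => k l; rewrite !mxE.
under eq_bigr do rewrite !mxE.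
rewrite (sum_oriented (fun p => (p.2 == enum_val k)%:R * (p.2 == enum_val l)%:R)).
under eq_bigr => e eH do rewrite /= sumr_const hH // eq_sym -mulrnAr.
rewrite sum_delta enum_valP mul1r (inj_eq enum_val_inj).
by rewrite mulrnAC.
Qed.

Lemma vertex_incidence_Tmul : V^T *m V = degree_matrix H S.
Proof.
apply/matrixP => x y; rewrite !mxE.
under eq_bigr do rewrite !mxE.
rewrite (sum_oriented (fun p => (p.1 == x)%:R * (p.1 == y)%:R)).
rewrite -sum1dep_card natr_sum big_mkcondr -sumrMnl; apply: eq_bigr => e eH /=.
under eq_bigr do rewrite eq_sym.
by rewrite sum_delta; case: ifP => _; case: eqP; rewrite ?mulr1 ?mulr0.
Qed.

Definition incidence : 'M[S]_(#|H|, n) :=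
  \matrix_(k < #|H|, x < n) (x \in (enum_val k : {set 'I_n}))%:R.

Lemma incidenceE : E^T *m V = incidence.
Proof.
apply/matrixP => k x; rewrite !mxE.
under eq_bigr do rewrite !mxE.
rewrite (sum_oriented (fun p => (p.2 == enum_val k)%:R * (p.1 == x)%:R)) /=.
under eq_bigr => e eH.
  rewrite -mulr_sumr eq_sym; under eq_bigr do rewrite eq_sym.
  rewrite sum_delta1; over.
by rewrite sum_delta enum_valP mul1r.
Qed.

Lemma incidence_Tmul :
  incidence^T *m incidence = adjacency H S + degree_matrix H S.
Proof.
apply/matrixP => x y; rewrite !mxE.
under eq_bigr do rewrite !mxE.
rewrite -(big_enum_val (fun e : {set 'I_n} => (x \in e)%:R * (y \in e)%:R)).
have -> : \sum_(e in H) (x \in e)%:R * (y \in e)%:R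
    = #|[set e in H | [set x; y] \subset e]|%:R :> S.
  rewrite -sum1dep_card natr_sum big_mkcondr; apply: eq_bigr => e eH /=.
  by rewrite subUset !sub1set -natrM mulnb; case: (_ && _).
(* On the diagonal the pair collapses to one vertex, so the count is the degree, while [adjacency]
   contributes 0. *)
case: eqP => [<-|_]; last by rewrite addr0.
by rewrite add0r setUid; congr _%:R; apply: eq_card => e; rewrite !inE sub1set.
Qed.

(** This is [K Q], the cross term in the expansion of [(K - 1) (Q - 1)]. *)
Lemma edge_incidence_vertexT :
  E *m incidence *m V^T =
  \matrix_(i < #|oriented H|, j < #|oriented H|)
    ((enum_val j).1 \in ((enum_val i).2 : {set 'I_n}))%:R.
Proof.
apply/matrixP => i j; rewrite !mxE.
under eq_bigr => x _.
  rewrite !mxE mulrC; under eq_bigr do rewrite !mxE.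
  rewrite -(big_enum_val (fun e : {set 'I_n} =>
    ((enum_val i).2 == e)%:R * (x \in e)%:R)) /=.
  rewrite sum_delta; case/andP: (enum_val_oriented i) => -> _; rewrite mul1r.
  over.
by rewrite (sum_delta predT) mul1r.
Qed.

(** A non-backtracking step first changes the vertex within the edge, [K - 1], then the edge at the
    new vertex, [Q - 1]. *)
Lemma nb_matrix_factor :
  nb_matrix H S = (E *m E^T - 1%:M) *m (V *m V^T - 1%:M).
Proof.
rewrite mulmxBl mulmxBr mulmx1 mul1mx mulmxA -[E *m _ *m V]mulmxA.
rewrite incidenceE edge_incidence_vertexT edge_incidence_mulT.
rewrite vertex_incidence_mulT.
apply/matrixP => i j; rewrite !mxE -(inj_eq enum_val_inj) /nb_step !inE.
case/andP: (enum_val_oriented i) (enum_val_oriented j) => _.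
case: (enum_val i) (enum_val j) => [x e] [y f] /= xe /andP[_ yf].
rewrite xpair_eqE (eq_sym x) (eq_sym e).
(* The entry is [[y in e] - [e = f] - [x = y] + [x = y, e = f]]; [xe] settles the case [y = x], and
   [yf] the case [f = e]. *)
case: (eqVneq y x) => [->|_]; case: (eqVneq f e) => [fe|_];
  rewrite ?xe -?fe ?yf ?andbF ?andbT ?subrr ?subr0 //.
Qed.

(* With [w = z - 1] and [w' = z + q - 1], the matrix [w' - K] is [w w'] times
   the inverse of [K + w], where [K = E *m E^T] satisfies [K *m K = q K]. *)
Lemma resolvent_nb_matrix (z : S) :
  let c := (z - 1) * (z + (q%:R - 1)) in
  let U := (z + (q%:R - 1))%:M - E *m E^T in
  U *m (z%:M - nb_matrix H S) = c%:M - (c%:M - z *: U) *m V *m V^T.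
Proof.
move=> c U.
have KK : (E *m E^T) *m (E *m E^T) = q%:R *: (E *m E^T).
  by rewrite mulmxA -[_ *m E^T *m E]mulmxA edge_incidence_Tmul mul_mx_scalar
    -scalemxAl.
(* Both sides equal [z K - w'], by [K^2 = q K]. *)
have UK : U *m (E *m E^T - 1%:M) = c%:M - z *: U.
  rewrite mulmxBr mulmx1 mulmxBl KK mul_scalar_mx /U /c.
  apply/matrixP => i j; rewrite !mxE; case: (i == j); rewrite ?mulr1n ?mulr0n; ring.
rewrite nb_matrix_factor mulmxBr mulmxA UK mulmxBr mulmx1 mul_mx_scalar.
by rewrite opprB addrA [X in X - _]addrC subrK mulmxA.
Qed.

(** Hypergraph form of the Ihara-Bass matrix: for [q = 2] it is [z^2 - z A + D - 1]. *)
Definition quadratic_pencil (z : S) : 'M[S]_n :=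
  (z ^+ 2 + (q%:R - 2%:R) * z) *: 1%:M - z *: adjacency H S
    + (q%:R - 1) *: (degree_matrix H S - 1%:M).

Lemma det_resolvent_nb_matrix (z : S) :
  (z + (q%:R - 1)) ^+ (q * #|H|) *
    ((z - 1) ^+ (#|H| + n) * (z + (q%:R - 1)) ^+ n
       * \det (z%:M - nb_matrix H S)) =
  (z + (q%:R - 1)) ^+ (q * #|H|) *
    ((z - 1) ^+ (q * #|H|) * (z + (q%:R - 1)) ^+ #|H|
       * \det (quadratic_pencil z)).
Proof.
set w := z - 1; set w' := z + (q%:R - 1).
pose U := w'%:M - E *m E^T.
(* Sylvester's identity for [E]: the small matrix is the scalar [w' - q = w]. *)
have detU : w' ^+ #|H| * \det U = w' ^+ (q * #|H|) * w ^+ #|H|.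
  rewrite det_scalar_sub_mulmxC edge_incidence_Tmul -rmorphB det_scalar.
  by rewrite card_oriented; congr (_ * _ ^+ _); rewrite /w /w'; ring.
have := congr1 determinant (resolvent_nb_matrix z).
(* These factors are the powers required by Sylvester's identity, for [E] in [detU] and for [V] on
   the right-hand side. *)
rewrite det_mulmx -/w -/w' -/U => /(congr1 (fun d => w' ^+ #|H| * ((w * w') ^+ n * d))).
rewrite det_scalar_sub_mulmxC.
(* As [c - z U = z K - w'], the left side is [w w' - z (A + D) + w' D], and [w' - z = q - 1]. *)
have -> : (w * w')%:M - V^T *m (((w * w')%:M - z *: U) *m V) = quadratic_pencil z.
  rewrite mulmxBl -scalemxAl mulmxBl !mul_scalar_mx.
  rewrite mulmxBr -!scalemxAr mulmxBr -scalemxAr !mulmxA.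
  rewrite vertex_incidence_Tmul -[_ *m _ *m V]mulmxA.
  rewrite incidenceE -[V^T *m E]trmxK trmx_mul trmxK incidenceE incidence_Tmul.
  rewrite /quadratic_pencil; move: (adjacency _ _) (degree_matrix _ _) => A D.
  apply/matrixP => i j; rewrite !mxE /w /w'; case: (i == j); rewrite ?mulr1n ?mulr0n; ring.
have wN : (w * w') ^+ #|oriented H| = (w * w') ^+ (q * #|H|).
  by rewrite card_oriented.
rewrite {}wN.
move: (\det (quadratic_pencil z)) => dL.
move: (\det (_ - nb_matrix _ _)) => dB.
move: (\det U) detU => dU; rewrite !exprMn exprD.
move: (w ^+ #|H|) (w' ^+ #|H|) => wm w'm.
move: (w ^+ n) (w' ^+ n) => wn w'n.
move: (w ^+ _) (w' ^+ _) => wN w'N detU h.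
transitivity (w'm * (wn * w'n * (dU * dB))); last by rewrite h; ring.
transitivity (w'N * wm * (wn * w'n * dB)); first by ring.
by rewrite -detU; ring.
Qed.

End Incidence.

(** * Compatibility with ring morphisms *)

Section Morphism.

Variables (n q : nat) (H : {set {set 'I_n}}).
Variables (S T : comPzRingType) (f : {rmorphism S -> T}).

Lemma map_nb_matrix : map_mx f (nb_matrix H S) = nb_matrix H T.
Proof. by apply/matrixP => i j; rewrite !mxE rmorph_nat. Qed.

Lemma map_adjacency : map_mx f (adjacency H S) = adjacency H T.
Proof.
by apply/matrixP => i j; rewrite !mxE; case: eqP; rewrite ?rmorph0 ?rmorph_nat.
Qed.

Lemma map_degree_matrix : map_mx f (degree_matrix H S) = degree_matrix H T.
Proof. by apply/matrixP => i j; rewrite !mxE rmorphMn rmorph_nat. Qed.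

Lemma map_nb_tilde : map_mx f (nb_tilde H S q) = nb_tilde H T q.
Proof.
rewrite map_block_mx /nb_tilde map_mx0 !map_mxB !map_mxZ !map_mx1.
by rewrite rmorphN !rmorphB (rmorph1 f) !rmorph_nat map_adjacency map_degree_matrix.
Qed.

Lemma map_quadratic_pencil (z : S) :
  map_mx f (quadratic_pencil q H z) = quadratic_pencil q H (f z).
Proof.
rewrite /quadratic_pencil map_mxD map_mxB !map_mxZ map_mxB !map_mx1.
rewrite map_adjacency map_degree_matrix.
by rewrite rmorphD rmorphXn rmorphM !rmorphB (rmorph1 f) !rmorph_nat.
Qed.

End Morphism.

(** * Characteristic polynomials and cancellation of surplus powers *)

(** Subtraction is truncated, so one of [a - b] and [b - a] is 0 and both orders of [a] and [b] are
    covered at once. *)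
Lemma expr_subn_cancel (S : idomainType) (x s t : S) (a b : nat) :
  x != 0 -> x ^+ a * s = x ^+ b * t -> x ^+ (a - b) * s = x ^+ (b - a) * t.
Proof.
move=> x0; have [/[dup] ab|/[dup] /ltnW ba] := leqP a b.
  rewrite -subn_eq0 => /eqP ->; rewrite expr0 mul1r -{1}(subnKC ab) exprD -mulrA.
  exact/mulfI/expf_neq0.
move=> /ltnW; rewrite -subn_eq0 => /eqP ->; rewrite expr0 mul1r.
rewrite -{1}(subnKC ba) exprD -mulrA; exact/mulfI/expf_neq0.
Qed.

Lemma char_poly_nb_tilde (F : idomainType) (n q : nat) (H : {set {set 'I_n}}) :
  char_poly (nb_tilde H F q) = \det (quadratic_pencil q H ('X : {poly F})).
Proof.
have X0 : ('X : {poly F}) ^+ n != 0 by rewrite expf_neq0 ?polyX_eq0.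
apply: (mulfI X0); rewrite /char_poly /char_poly_mx map_nb_tilde.
rewrite /nb_tilde scalar_mx_block opp_block_mx add_block_mx.
rewrite subr0 sub0r scaleNr opprK !scalemx1 add0r.
rewrite det_block_scalarl; congr (_ * \det _).
rewrite /quadratic_pencil; move: (adjacency _ _) (degree_matrix _ _) => A D.
apply/matrixP => i j; rewrite !mxE.
by case: (i == j); rewrite ?mulr1n ?mulr0n; ring.
Qed.

Section CharPoly.

Variables (F : fieldType) (n q : nat) (H : {set {set 'I_n}}).
Hypotheses (hq : (0 < q)%N) (hH : uniform_hypergraph H q).

Local Notation w := ('X - 1%:P : {poly F}).
Local Notation w' := ('X - (- (q%:R - 1))%:P : {poly F}).

Lemma char_poly_nb_matrix :
  w ^+ (n - (q - 1) * #|H|) * w' ^+ (n - #|H|) * char_poly (nb_matrix H F) =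
  w ^+ ((q - 1) * #|H| - n) * w' ^+ (#|H| - n) * char_poly (nb_tilde H F q).
Proof.
have w0 : w != 0 by rewrite polyXsubC_eq0.
have w'0 : w' != 0 by rewrite polyXsubC_eq0.
have := det_resolvent_nb_matrix hH ('X : {poly F}).
rewrite -char_poly_nb_tilde -(map_nb_matrix _ polyC) -[\det (_ - _)]/(char_poly _).
have -> : ('X + (q%:R - 1) : {poly F}) = w'.
  by rewrite rmorphN rmorphB rmorph_nat opprK.
have <- : 'X - 1 = w by [].
(* Exposes a common factor [w ^+ #|H|]; what then remains is [n] against [(q - 1) * #|H|] for [w],
   and [n] against [#|H|] for [w']. *)
have -> : (q * #|H| = #|H| + (q - 1) * #|H|)%N by rewrite -mulSn; congr muln; lia.
move/(mulfI (expf_neq0 _ w'0)).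
rewrite !exprD -!mulrA => /(mulfI (expf_neq0 _ w0)).
move/(expr_subn_cancel w0); rewrite mulrCA [RHS]mulrCA.
by move/(expr_subn_cancel w'0); rewrite mulrCA [RHS]mulrCA.
Qed.

(** [mup] is additive on nonzero products, and a power of a linear factor counts only at its own
    root. *)
Lemma mup_char_poly_nb_matrix (z : F) :
  ((1 == z)%R * (n - (q - 1) * #|H|) + (- (q%:R - 1) == z)%R * (n - #|H|)
    + mup z (char_poly (nb_matrix H F)))%N =
  ((1 == z)%R * ((q - 1) * #|H| - n) + (- (q%:R - 1) == z)%R * (#|H| - n)
    + mup z (char_poly (nb_tilde H F q)))%N.
Proof.
have Hc m (A : 'M[F]_m) : char_poly A != 0 by rewrite monic_neq0 ?char_poly_monic.
have w0 k : w ^+ k != 0 by rewrite expf_neq0 ?polyXsubC_eq0.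
have w'0 k : w' ^+ k != 0 by rewrite expf_neq0 ?polyXsubC_eq0.
have := congr1 (mup z) char_poly_nb_matrix.
rewrite !mupM ?mulf_neq0 // !mup_XsubCX.
by do 2!case: (_ == z); rewrite ?mul1n ?mul0n.
Qed.

End CharPoly.

Lemma horner_char_poly (S : comNzRingType) (n : nat) (A : 'M[S]_n) (z : S) :
  (char_poly A).[z] = \det (z%:M - A).
Proof.
rewrite -horner_evalE -det_map_mx /char_poly_mx map_mxB map_scalar_mx /=.
rewrite horner_evalE hornerX -map_mx_comp map_mx_id // => a.
exact: hornerC.
Qed.

Lemma horner_char_poly_nb_tilde (F : idomainType) (n q : nat)
    (H : {set {set 'I_n}}) (z : F) :
  (char_poly (nb_tilde H F q)).[z] = \det (quadratic_pencil q H z).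
Proof.
rewrite char_poly_nb_tilde -horner_evalE -det_map_mx map_quadratic_pencil /=.
by rewrite horner_evalE hornerX.
Qed.

(** Passes from truncated exponents to an integer one; only a negative exponent requires inverting
    [x]. *)
Lemma exprz_subn_cancel (F : fieldType) (x s t : F) (a b : nat) :
  (0 <= b%:Z - a%:Z) || (x != 0) ->
  x ^+ (a - b) * s = x ^+ (b - a) * t -> s = x ^ (b%:Z - a%:Z) * t.
Proof.
have [ab _|ba] := leqP a b.
  by rewrite subzn // (eqP (ab : a - b == 0)%N) mul1r.
rewrite subr_ge0 lez_nat leqNgt ba /= => x0.
rewrite (eqP (ltnW ba : b - a == 0)%N) mul1r -opprB subzn ?(ltnW ba) //.
by rewrite -invr_expz => <-; rewrite mulKf // expf_neq0.
Qed.

(** * The determinant identity and the spectra over the complex numbers *)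

Theorem lemma1 (R : realType) (q n m : nat) (H : {set {set 'I_n}})
    (hq : (2 <= q)%N) (hH : uniform_hypergraph H q) (hm : m = #|H|) :
  let B : 'M[R[i]]_#|oriented H| := nb_matrix H R[i] in
  let A : 'M[R[i]]_n := adjacency H R[i] in
  let D : 'M[R[i]]_n := degree_matrix H R[i] in
  let Bt : 'M[R[i]]_(n + n) := nb_tilde H R[i] q in
  let e1 : int := (q%:Z - 1) * m%:Z - n%:Z in
  let e2 : int := m%:Z - n%:Z in
  let L (z : R[i]) : 'M[R[i]]_n :=
    (z ^+ 2 + (q%:R - 2%:R) * z) *: 1%:M - z *: A
      + (q%:R - 1) *: (D - 1%:M) in
  [/\ (* the determinant identity, wherever the integer powers make sense *)
      forall z : R[i],
        (0 <= e1) || (z != 1) ->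
        (0 <= e2) || (z != - (q%:R - 1)) ->
        \det (B - z *: 1%:M) =
          (-1) ^+ (q * m) *
          ((z - 1) ^ e1 * (z + (q%:R - 1)) ^ e2 * \det (L z)),
      (* the same identity at every z, negative powers moved to the left *)
      forall z : R[i],
        (z - 1) ^+ (n - (q - 1) * m) * (z + (q%:R - 1)) ^+ (n - m)
          * \det (B - z *: 1%:M) =
          (-1) ^+ (q * m) *
          ((z - 1) ^+ ((q - 1) * m - n) * (z + (q%:R - 1)) ^+ (m - n)
            * \det (L z)),
      (* the spectra agree, with algebraic multiplicity, off 1 and -(q-1) *)
      forall z : R[i], z != 1 -> z != - (q%:R - 1) ->
        eigenvalue B z = eigenvalue Bt z /\
        mup z (char_poly B) = mup z (char_poly Bt)
    & (* the trivial eigenvalues which B has in addition to those of Bt *)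
      (n <= m)%N ->
        mup 1 (char_poly B) =
          ((q - 1) * m - n + mup 1 (char_poly Bt))%N /\
        mup (- (q%:R - 1)) (char_poly B) =
          (m - n + mup (- (q%:R - 1)) (char_poly Bt))%N].
Proof.
move=> B A D Bt e1 e2 L; subst m.
(* The sign compares [B - z] with [z - B], of size [q * #|H|]. *)
have detB z : \det (B - z *: 1%:M) = (-1) ^+ (q * #|H|) * (char_poly B).[z].
  rewrite horner_char_poly -(card_oriented hH) -detZ scaleN1r opprB.
  by rewrite scalemx1.
have detL z : \det (L z) = (char_poly Bt).[z].
  by rewrite horner_char_poly_nb_tilde.
have q0 : (0 < q)%N by apply: leq_trans hq.
have mulq : (n <= #|H| -> n <= (q - 1) * #|H|)%N.
  by move/leq_trans; apply; rewrite leq_pmull // subn_gt0.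
have det_id z : (z - 1) ^+ (n - (q - 1) * #|H|) *
    (z + (q%:R - 1)) ^+ (n - #|H|) * \det (B - z *: 1%:M) =
    (-1) ^+ (q * #|H|) * ((z - 1) ^+ ((q - 1) * #|H| - n) *
      (z + (q%:R - 1)) ^+ (#|H| - n) * \det (L z)).
  rewrite detB detL mulrCA; congr (_ * _).
  have := congr1 (horner^~ z) (char_poly_nb_matrix R[i] q0 hH).
  by rewrite /= !(hornerM, horner_exp, hornerXsubC) opprK.
have mup_id := mup_char_poly_nb_matrix q0 hH.
(* The two trivial eigenvalues differ by [q], which is nonzero in characteristic 0. *)
have one_neq : (1 == - (q%:R - 1) :> R[i]) = false.
  by rewrite opprB -subr_eq0 opprB addrCA subrr addr0 pnatr_eq0 eqn0Ngt q0.
split=> [z h1 h2|//|z z1 zq|nm].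
- have e1E : e1 = ((q - 1) * #|H|)%N%:Z - n%:Z by rewrite PoszM -subzn.
  rewrite e1E in h1 *; rewrite mulrA [_ * (_ * _)]mulrCA -mulrA.
  apply: exprz_subn_cancel; first by rewrite subr_eq0.
  rewrite [RHS]mulrCA -[(-1) ^+ _ * _ * _]mulrA [RHS]mulrCA.
  apply: exprz_subn_cancel; first by rewrite addr_eq0.
  rewrite mulrCA mulrA det_id.
  by rewrite [RHS]mulrCA [in RHS](mulrCA (_ ^+ (#|H| - n))) -!mulrA.
- have /= := mup_id R[i] z; rewrite ![_ == z]eq_sym (negPf z1) (negPf zq) !mul0n.
  rewrite !add0n => mupE; split=> //; rewrite !eigenvalue_root_char.
  (* Eigenvalues are the points of positive multiplicity, so [mupE] also gives the equality of
     spectra. *)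
  have Hr k (C : 'M[R[i]]_k) : root (char_poly C) z = (0 < mup z (char_poly C))%N.
    by rewrite -XsubC_dvd ?monic_neq0 ?char_poly_monic // dvdp_XsubCl.
  by rewrite !Hr mupE.
(* For [n <= #|H|] both truncated exponents on the side of [B] vanish, leaving the surplus on the
   side of [Bt]. *)
- have n1 : (n - #|H|)%N = 0%N by apply/eqP.
  have n2 : (n - (q - 1) * #|H|)%N = 0%N by apply/eqP/mulq.
  split.
    have := mup_id R[i] 1; rewrite n1 n2 eqxx [- _ == 1]eq_sym one_neq.
    by rewrite !muln0 !mul0n mul1n !addn0 !add0n.
  have := mup_id R[i] (- (q%:R - 1)); rewrite n1 n2 eqxx one_neq.
  by rewrite !muln0 !mul0n mul1n !add0n.
Qed.
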